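(* Let $V_1\in[0,1)$. The function $G^{\max}_{V_1}:\mathbb{R}\to\mathbb{R}$ is $\pi$-periodic, even, and oscillates monotonically between the extreme values $$\max_{\gamma\in\mathbb{R}}G^{\max}_{V_1}(\gamma)=\sqrt{\frac{1+V_1}{1-V_1}}\quad\text{and}\quad \min_{\gamma\in\mathbb{R}}G^{\max}_{V_1}(\gamma)=1 .$$ The maximum value is achieved if $\gamma$ is an odd multiple of $\frac{\pi}{2}$ and the minimum value is achieved if $\gamma$ is a multiple of $\pi$. The function $G^{\min}_{V_1}:\mathbb{R}\to\mathbb{R}$ is $\pi$-periodic, even, and oscillates monotonically between the extreme values $$\max_{\gamma\in\mathbb{R}}G^{\min}_{V_1}(\gamma)=1\quad\text{and}\quad \min_{\gamma\in\mathbb{R}}G^{\min}_{V_1}(\gamma)=\sqrt{\frac{1-V_1}{1+V_1}} .$$ The maximum value is achieved if $\gamma$ is a multiple of $\pi$ and the minimum value is achieved if $\gamma$ is an odd multiple of $\frac{\pi}{2}$.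
   Context: For $V,W\in[0,1)$: $f_{VW}(\alpha,x):=\dfrac{1+V\cos(x+\alpha)}{1-W\cos\alpha}$, $f^{\max}_{VW}(x):=\max_{\alpha\in\mathbb{R}}f_{VW}(\alpha,x)$, $f^{\min}_{VW}(x):=\min_{\alpha\in\mathbb{R}}f_{VW}(\alpha,x)$, $x\in\mathbb{R}$. Then $G^{\max}_{V_1}(\gamma):=\sqrt{f^{\max}_{V_1V_1}(2\gamma-\pi)}$ and $G^{\min}_{V_1}(\gamma):=\sqrt{f^{\min}_{V_1V_1}(2\gamma-\pi)}$, $\gamma\in\mathbb{R}$ (both subscripts of $f$ equal to $V_1$). ''Oscillates monotonically between its extreme values'' means: on each closed interval whose endpoints are two consecutive points among those listed as achieving the maximum and the minimum, the function is monotone (not necessarily strictly), going from the maximum value to the minimum value or vice versa. *)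

(* Defs.v *)
From mathcomp Require Import all_boot all_order all_algebra.
From mathcomp Require Import all_classical all_reals all_analysis.

Set Implicit Arguments.
Unset Strict Implicit.
Unset Printing Implicit Defensive.

Import Order.TTheory GRing.Theory Num.Theory.
Import numFieldTopology.Exports numFieldNormedType.Exports.

Local Open Scope classical_set_scope.
Local Open Scope ring_scope.

Section Definitions.
Variable R : realType.
Implicit Types (V W alpha x gamma a b M m : R) (A P Q : set R) (g : R -> R).

(* An attained bound, as opposed to [supremums] / [infimums]. *)
Definition maxima A : set R := A `&` ubound A.
Definition minima A : set R := A `&` lbound A.

Definition fVW V W alpha x : R :=
  (1 + V * cos (x + alpha)) / (1 - W * cos alpha).

(* [get] picks the maximum (minimum) over alpha, which is unique; that it
   exists for W in [0, 1) is [fmaxP] ([fminP]) below. *)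
Definition fmax V W x : R := get (maxima (range (fun alpha => fVW V W alpha x))).
Definition fmin V W x : R := get (minima (range (fun alpha => fVW V W alpha x))).

Definition Gmax V gamma : R := Num.sqrt (fmax V V (gamma *+ 2 - pi)).
Definition Gmin V gamma : R := Num.sqrt (fmin V V (gamma *+ 2 - pi)).

Definition multiples_pi : set R := [set k%:~R * pi | k in [set: int]].
Definition odd_multiples_pihalf : set R :=
  [set (2 * k + 1)%:~R * (pi / 2) | k in [set: int]].

Definition consecutive A a b : Prop :=
  [/\ A a, A b, a < b & forall c, A c -> ~~ (a < c < b)].

(* P lists points where g takes its maximum M, Q points where it takes its
   minimum m. The monotonicity is not strict. *)
Definition oscillates_monotonically g M m P Q : Prop :=
  forall a b, consecutive (P `|` Q) a b ->
    [/\ g a = M, g b = m & {in `[a, b] &, {homo g : x y /~ x <= y}}] \/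
    [/\ g a = m, g b = M & {in `[a, b] &, {homo g : x y / x <= y}}].

Lemma fVW_denom_gt0 W alpha : 0 <= W < 1 -> 0 < 1 - W * cos alpha.
Proof.
move=> /andP[W0 W1]; rewrite subr_gt0 (le_lt_trans _ W1)//.
by rewrite ler_piMr// cos_le1.
Qed.

Lemma fVW_continuous V W x : 0 <= W < 1 ->
  continuous (fun alpha => fVW V W alpha x).
Proof.
move=> W01 alpha; rewrite /fVW.
apply: cvgM.
  apply: cvgD; first exact: cvg_cst.
  apply: cvgM; first exact: cvg_cst.
  apply: (@continuous_comp _ _ _ (fun t => x + t) cos); last exact: continuous_cos.
  by apply: cvgD; [exact: cvg_cst|exact: cvg_id].
apply: cvgV; first by rewrite gt_eqF// fVW_denom_gt0.
apply: cvgB; first exact: cvg_cst.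
by apply: cvgM; [exact: cvg_cst|exact: continuous_cos].
Qed.

Lemma fVW_periodic V W x :
  periodic (fun alpha => fVW V W alpha x) (pi *+ 2 : R).
Proof. by move=> alpha; rewrite /fVW addrA !cosD2pi. Qed.

Lemma fVW_reduce V W x alpha :
  exists2 beta, beta \in `[0, pi *+ 2] & fVW V W alpha x = fVW V W beta x.
Proof.
have p0 : 0 < pi *+ 2 :> R by rewrite pmulrn_lgt0// pi_gt0.
pose k := Num.floor (alpha / (pi *+ 2)).
have perZ (n : int) t : fVW V W (t + (pi *+ 2) *~ n) x = fVW V W t x.
  case: n => n; first by rewrite -pmulrn (periodicn (fVW_periodic V W x)).
  rewrite NegzE mulrNz -pmulrn.
  by rewrite -[LHS](periodicn (fVW_periodic V W x) n.+1) subrK.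
exists (alpha - (pi *+ 2) *~ k); last by rewrite -mulrNz perZ.
have kle := real_floor_itv (num_real (alpha / (pi *+ 2))).
rewrite in_itv/= subr_ge0 -mulrzl; move: kle; rewrite -/k.
rewrite ler_pdivlMr// ltr_pdivrMr// => /andP[-> kl] /=.
by rewrite lerBlDr ltW// (lt_le_trans kl)// intrD mulrDl mul1r addrC.
Qed.

Lemma fmaxP V W x : 0 <= W < 1 ->
  maxima (range (fun alpha => fVW V W alpha x)) (fmax V W x).
Proof.
move=> W01.
have p0 : 0 <= pi *+ 2 :> R by rewrite mulrn_wge0// pi_ge0.
have [|c _ cmax] := EVT_max p0 (f := fun alpha => fVW V W alpha x).
  by apply: continuous_subspaceT; exact: fVW_continuous.
apply: (@getPex _ (maxima _)); exists (fVW V W c x); split; first by exists c.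
by move=> _ [alpha _ <-]; have [beta bI ->] := fVW_reduce V W x alpha; exact: cmax.
Qed.

Lemma fminP V W x : 0 <= W < 1 ->
  minima (range (fun alpha => fVW V W alpha x)) (fmin V W x).
Proof.
move=> W01.
have p0 : 0 <= pi *+ 2 :> R by rewrite mulrn_wge0// pi_ge0.
have [|c _ cmin] := EVT_min p0 (f := fun alpha => fVW V W alpha x).
  by apply: continuous_subspaceT; exact: fVW_continuous.
apply: (@getPex _ (minima _)); exists (fVW V W c x); split; first by exists c.
by move=> _ [alpha _ <-]; have [beta bI ->] := fVW_reduce V W x alpha; exact: cmin.
Qed.

End Definitions.

Arguments multiples_pi : clear implicits.
Arguments odd_multiples_pihalf : clear implicits.

(* Main.v *)
(** With alpha = b - gamma the function to be optimized is
    (1 - V cos(b + gamma)) / (1 - V cos(b - gamma)). Expanding the cosines and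
    applying Cauchy-Schwarz shows that its maximum over b is
    (D + V t) / (D - V t), where t = |sin gamma| and D^2 = 1 - V^2 + (V t)^2.
    Since (D + V t) (D - V t) = 1 - V^2, this is the square of
    (V t + D) / sqrt(1 - V^2), so Gmax is an increasing function of |sin gamma|.
    The substitution b -> - b inverts the quotient, whence Gmin = 1 / Gmax. *)
Require Import Defs.
From mathcomp Require Import all_boot all_order all_algebra.
From mathcomp Require Import all_classical all_reals all_analysis.
From mathcomp Require Import ring lra zify.

Set Implicit Arguments.
Unset Strict Implicit.
Unset Printing Implicit Defensive.

Import Order.TTheory GRing.Theory Num.Theory.
Local Open Scope classical_set_scope.
Local Open Scope ring_scope.

(** * Uniqueness of extrema and their transport along monotone maps *)

Lemma maxima_unique (R : realType) (A : set R) (x y : R) :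
  maxima A x -> maxima A y -> x = y.
Proof.
by move=> [Ax xA] [Ay yA]; apply: le_anti; rewrite (yA _ Ax) (xA _ Ay).
Qed.

Lemma minima_unique (R : realType) (A : set R) (x y : R) :
  minima A x -> minima A y -> x = y.
Proof.
by move=> [Ax xA] [Ay yA]; apply: le_anti; rewrite (yA _ Ax) (xA _ Ay).
Qed.

(** This lemma and the next ones pass from |sin| to a monotone function of it. Monotonicity of [phi]
    is asked only on nonnegative arguments, since [h] takes no other values and the profile below is
    treated only there. *)
Lemma maxima_range_nondecreasing (R : realType) (phi h : R -> R) (M : R) :
  (forall x, 0 <= h x) -> {in Num.nneg &, {homo phi : x y / x <= y}} ->
  maxima (range h) M -> maxima (range (phi \o h)) (phi M).
Proof.
move=> h0 phi_nd [[x _ <-] hM]; split; first by exists x.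
by move=> _ [y _ <-]; apply: phi_nd; rewrite ?nnegrE// hM//; exists y.
Qed.

Lemma minima_range_nondecreasing (R : realType) (phi h : R -> R) (m : R) :
  (forall x, 0 <= h x) -> {in Num.nneg &, {homo phi : x y / x <= y}} ->
  minima (range h) m -> minima (range (phi \o h)) (phi m).
Proof.
move=> h0 phi_nd [[x _ <-] hm]; split; first by exists x.
by move=> _ [y _ <-]; apply: phi_nd; rewrite ?nnegrE// hm//; exists y.
Qed.

Lemma minima_range_nonincreasing (R : realType) (phi h : R -> R) (M : R) :
  (forall x, 0 <= h x) -> {in Num.nneg &, {homo phi : x y /~ x <= y}} ->
  maxima (range h) M -> minima (range (phi \o h)) (phi M).
Proof.
move=> h0 phi_ni [[x _ <-] hM]; split; first by exists x.
by move=> _ [y _ <-]; apply: phi_ni; rewrite ?nnegrE// hM//; exists y.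
Qed.

Lemma maxima_range_nonincreasing (R : realType) (phi h : R -> R) (m : R) :
  (forall x, 0 <= h x) -> {in Num.nneg &, {homo phi : x y /~ x <= y}} ->
  minima (range h) m -> maxima (range (phi \o h)) (phi m).
Proof.
move=> h0 phi_ni [[x _ <-] hm]; split; first by exists x.
by move=> _ [y _ <-]; apply: phi_ni; rewrite ?nnegrE// hm//; exists y.
Qed.

Lemma oscillates_comp_nondecreasing (R : realType) (phi h : R -> R) (M m : R)
    (P Q : set R) :
  (forall x, 0 <= h x) -> {in Num.nneg &, {homo phi : x y / x <= y}} ->
  oscillates_monotonically h M m P Q ->
  oscillates_monotonically (phi \o h) (phi M) (phi m) P Q.
Proof.
move=> h0 phi_nd hosc a b /hosc[[<- <- hab]|[<- <- hab]]; [left|right];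
by split=> // x y xab yab xy; apply: phi_nd; rewrite ?nnegrE// hab.
Qed.

(** An order-reversing map exchanges maxima and minima, so the two point sets and the two extreme
    values trade places. *)
Lemma oscillates_comp_nonincreasing (R : realType) (phi h : R -> R) (M m : R)
    (P Q : set R) :
  (forall x, 0 <= h x) -> {in Num.nneg &, {homo phi : x y /~ x <= y}} ->
  oscillates_monotonically h M m P Q ->
  oscillates_monotonically (phi \o h) (phi m) (phi M) Q P.
Proof.
move=> h0 phi_ni hosc a b; rewrite setUC.
move=> /hosc[[<- <- hab]|[<- <- hab]]; [right|left];
by split=> // x y xab yab xy; apply: phi_ni; rewrite ?nnegrE// hab.
Qed.

(** * Periodicity, extrema and oscillation of |sin| *)

Lemma int_parity (k : int) : (exists j, k = 2 * j) \/ (exists j, k = 2 * j + 1).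
Proof.
have [->|->] : k = 2 * (k %/ 2)%Z \/ k = 2 * (k %/ 2)%Z + 1 by lia.
  by left; exists (k %/ 2)%Z.
by right; exists (k %/ 2)%Z.
Qed.

Lemma norm_sinDpi (R : realType) : periodic (fun x : R => `|sin x|) pi.
Proof. by move=> x; rewrite sinDpi normrN. Qed.

Lemma norm_sinDzpi (R : realType) (x : R) (k : int) :
  `|sin (x + k%:~R * pi)| = `|sin x|.
Proof.
rewrite mulrzl; case: k => n; first exact: (periodicn (@norm_sinDpi R) n x).
rewrite NegzE mulrNz -pmulrn.
by rewrite -(periodicn (@norm_sinDpi R) n.+1) subrK.
Qed.

Lemma norm_sin_multiples_pi (R : realType) (x : R) :
  multiples_pi R x -> `|sin x| = 0.
Proof. by move=> [k _ <-]; rewrite -[_ * _]add0r norm_sinDzpi sin0 normr0. Qed.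

Lemma norm_sin_odd_multiples_pihalf (R : realType) (x : R) :
  odd_multiples_pihalf R x -> `|sin x| = 1.
Proof.
move=> [k _ <-]; have -> : (2 * k + 1)%:~R * (pi / 2) = pi / 2 + k%:~R * pi :> R.
  by rewrite intrD intrM; field.
by rewrite norm_sinDzpi sin_pihalf normr1.
Qed.

Lemma maxima_norm_sin (R : realType) : maxima (range (fun x : R => `|sin x|)) 1.
Proof.
split; first by exists (pi / 2); rewrite // sin_pihalf normr1.
by move=> _ [x _ <-]; exact: sin_max.
Qed.

Lemma minima_norm_sin (R : realType) : minima (range (fun x : R => `|sin x|)) 0.
Proof.
split; first by exists 0; rewrite // sin0 normr0.
by move=> _ [x _ <-]; exact: normr_ge0.
Qed.

(** Even and odd multiples of pi/2 together form a lattice of constant step, in which consecutive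
    points are easy to describe. *)
Lemma multiples_pihalfE (R : realType) :
  odd_multiples_pihalf R `|` multiples_pi R =
  [set k%:~R * (pi / 2) | k in [set: int]].
Proof.
apply/seteqP; split=> [_ [[k _ <-]|[k _ <-]]|_ [k _ <-]].
- by exists (2 * k + 1).
- by exists (2 * k) => //; rewrite intrM; field.
- have [[j ->]|[j ->]] := int_parity k.
  + by right; exists j => //; rewrite intrM; field.
  + by left; exists j.
Qed.

(** If the second index exceeded [k + 1], the point [(k + 1)%:~R * c] would lie strictly between the
    two. *)
Lemma consecutive_multiples (R : realType) (c a b : R) : 0 < c ->
  consecutive [set k%:~R * c | k in [set: int]] a b ->
  exists k : int, a = k%:~R * c /\ b = (k + 1)%:~R * c.
Proof.
move=> c0 [[k _ <-] [l _ <-] + noc]; rewrite ltr_pM2r// ltr_int => kl.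
exists k; split=> //; have [kl1|] := ltP (k + 1) l; last first.
  by move=> lk; congr (_%:~R * _); lia.
have /noc : [set k%:~R * c | k in [set: int]] ((k + 1)%:~R * c) by exists (k + 1).
by rewrite !ltr_pM2r// !ltr_int kl1 andbT; lia.
Qed.

Lemma norm_sin_nondecreasing (R : realType) :
  {in `[0, pi / 2] &, {homo (fun x : R => `|sin x|) : x y / x <= y}}.
Proof.
move=> x y; rewrite !in_itv/= => /andP[x0 xp] /andP[y0 yp] xy.
have p0 := pi_gt0 R.
rewrite !ger0_norm ?sin_ge0_pi//; [|lra|lra].
move: xy; rewrite le_eqVlt => /predU1P[->//|xy].
by apply: ltW; rewrite ltr_sin// in_itv/=; lra.
Qed.

(** The parity of the index of the left endpoint decides the direction; translations by multiples of
    pi and a reflection reduce both cases to [0, pi/2]. *)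
Lemma oscillates_norm_sin (R : realType) :
  oscillates_monotonically (fun x : R => `|sin x|) 1 0
    (odd_multiples_pihalf R) (multiples_pi R).
Proof.
move=> a b; rewrite multiples_pihalfE; have p0 := pi_gt0 R.
move=> /consecutive_multiples[|k [-> ->]]; first by lra.
have [[j ->]|[j ->]] := int_parity k.
- right; split.
  + by apply: norm_sin_multiples_pi; exists j => //; rewrite intrM; field.
  + by apply: norm_sin_odd_multiples_pihalf; exists j.
  + move=> x y; rewrite !in_itv/= => xI yI xy.
    (* Shifting by [- j] periods carries the interval to [0, pi/2]. *)
    rewrite -(norm_sinDzpi x (- j)) -(norm_sinDzpi y (- j)).
    move: xI yI; rewrite !(intrD, intrM, intrN) => xI yI.
    by apply: norm_sin_nondecreasing; rewrite ?in_itv/=; lra.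
- left; split.
  + by apply: norm_sin_odd_multiples_pihalf; exists j.
  + by apply: norm_sin_multiples_pi; exists (j + 1) => //;
      rewrite !(intrD, intrM); field.
  + move=> x y; rewrite !in_itv/= => xI yI xy.
    (* This shift carries the interval to [-pi/2, 0]; the negation that follows moves it to
       [0, pi/2] and reverses the order. *)
    rewrite -(norm_sinDzpi x (- (j + 1))) -(norm_sinDzpi y (- (j + 1))).
    rewrite -normrN -sinN -[leRHS]normrN -sinN.
    move: xI yI; rewrite !(intrD, intrM, intrN) => xI yI.
    by apply: norm_sin_nondecreasing; rewrite ?in_itv/=; lra.
Qed.

(** * The closed form as a function of t = |sin gamma| *)

Definition profile (R : realType) (V t : R) : R :=
  (V * t + Num.sqrt (1 - V ^+ 2 + (V * t) ^+ 2)) / Num.sqrt (1 - V ^+ 2).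

Lemma subr1_sqr_gt0 (R : realType) (V : R) : 0 <= V < 1 -> 0 < 1 - V ^+ 2.
Proof. by move=> V01; nra. Qed.

Lemma profile_gt0 (R : realType) (V t : R) : 0 <= V < 1 -> 0 <= t -> 0 < profile V t.
Proof.
move=> V01 t0; have V2 := subr1_sqr_gt0 V01; have /andP[V0 _] := V01.
rewrite divr_gt0 ?sqrtr_gt0// ltr_wpDl ?mulr_ge0// sqrtr_gt0.
by rewrite ltr_wpDr ?sqr_ge0.
Qed.

Lemma profile_nondecreasing (R : realType) (V : R) : 0 <= V < 1 ->
  {in Num.nneg &, {homo profile V : s t / s <= t}}.
Proof.
move=> V01 s t; rewrite !nnegrE => s0 t0 st; have /andP[V0 _] := V01.
rewrite ler_pM2r ?invr_gt0 ?sqrtr_gt0 ?subr1_sqr_gt0//.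
apply: lerD; first exact: ler_wpM2l.
by rewrite ler_wsqrtr// lerD2l lerXn2r ?nnegrE ?mulr_ge0// ler_wpM2l.
Qed.

Lemma profile0 (R : realType) (V : R) : 0 <= V < 1 -> profile V 0 = 1.
Proof.
move=> /subr1_sqr_gt0 V2; rewrite /profile mulr0 expr0n addr0 add0r divff//.
by rewrite gt_eqF ?sqrtr_gt0.
Qed.

(** At t = 1 the inner radicand is 1, and 1 - V^2 = (1 - V)(1 + V) makes (1 + V)/(1 - V) the square
    of what remains. *)
Lemma profile1 (R : realType) (V : R) : 0 <= V < 1 ->
  profile V 1 = Num.sqrt ((1 + V) / (1 - V)).
Proof.
move=> V01; have V2 := subr1_sqr_gt0 V01; have /andP[V0 V1] := V01.
have S0 : 0 < Num.sqrt (1 - V ^+ 2) by rewrite sqrtr_gt0.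
have -> : (1 + V) / (1 - V) = ((V + 1) / Num.sqrt (1 - V ^+ 2)) ^+ 2.
  rewrite expr_div_n sqr_sqrtr ?ltW//; field.
  by rewrite !gt_eqF//; lra.
rewrite sqrtr_sqr ger0_norm; last by rewrite divr_ge0 ?ltW//; lra.
by rewrite /profile mulr1 subrK sqrtr1.
Qed.

(** * Extrema of the quotient over alpha, and closed forms of [Gmax] and [Gmin] *)

Lemma fVW_shift (R : realType) (V b g : R) :
  fVW V V (b - g) (g *+ 2 - pi) = (1 - V * cos (b + g)) / (1 - V * cos (b - g)).
Proof.
rewrite /fVW; have -> : g *+ 2 - pi + (b - g) = b + g - pi by ring.
(* The phase -pi is what changes the sign of the cosine in the numerator. *)
by rewrite -[b + g in RHS](subrK pi) cosDpi mulrN opprK.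
Qed.

Lemma maxima_fVW (R : realType) (V g : R) : 0 <= V < 1 ->
  maxima (range (fun alpha => fVW V V alpha (g *+ 2 - pi))) (profile V `|sin g| ^+ 2).
Proof.
move=> V01; have V2 := subr1_sqr_gt0 V01; have /andP[V0 V1] := V01.
set t := `|sin g|; set c := cos g.
have t0 : 0 <= t by exact: normr_ge0.
have ct : c ^+ 2 + t ^+ 2 = 1 by rewrite /t real_normK ?num_real// cos2Dsin2.
set D := Num.sqrt (1 - V ^+ 2 + (V * t) ^+ 2).
have D2 : D ^+ 2 = 1 - V ^+ 2 + (V * t) ^+ 2.
  by rewrite sqr_sqrtr// addr_ge0 ?sqr_ge0// ltW.
have D0 : 0 <= D by exact: sqrtr_ge0.
have uD : V * t < D by have := mulr_ge0 V0 t0; nra.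
have -> : profile V t ^+ 2 = (D + V * t) / (D - V * t).
  rewrite /profile -/D expr_div_n sqr_sqrtr ?ltW//.
  have -> : 1 - V ^+ 2 = (D - V * t) * (D + V * t) by nra.
  by field; rewrite !gt_eqF//; have := mulr_ge0 V0 t0; nra.
have DC : D ^+ 2 + (V * c) ^+ 2 = 1 by rewrite D2 exprMn; nra.
have sgE : sin g = Num.sg (sin g) * t by rewrite /t -numEsg.
(* Only an inequality, because the sign is 0 when [sin g] vanishes; the upper bound needs no
   more. *)
have sg2 : Num.sg (sin g) ^+ 2 <= 1.
  by rewrite sqr_sg; case: (_ != 0); rewrite ?ler01.
split.
(* Equality in Cauchy-Schwarz: cos b = V c and sin b = +/- D. *)
- have VcI : -1 <= V * c <= 1 by nra.
  pose b := if 0 <= sin g then acos (V * c) else - acos (V * c).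
  have cb : cos b = V * c.
    by rewrite /b; case: ifP => _; rewrite ?cosN acosK// in_itv.
  have sb : sin g * sin b = t * D.
    have sD : Num.sqrt (1 - (V * c) ^+ 2) = D.
      by rewrite -DC addrK sqrtr_sqr ger0_norm.
    rewrite /b /t; case: ifPn => [s0|]; first by rewrite sin_acos// sD ger0_norm.
    by rewrite -ltNge => s0; rewrite sinN sin_acos// sD ltr0_norm// mulrN mulNr.
  exists (b - g) => //; rewrite fVW_shift cosD cosB -/c cb.
  have -> : sin b * sin g = t * D by rewrite mulrC.
  have E : 1 - V * (V * c * c) = D ^+ 2 by rewrite -DC; ring.
  have Dp : 0 < D by have := mulr_ge0 V0 t0; lra.
  have -> : 1 - V * (V * c * c - t * D) = D * (D + V * t) by nra.
  have -> : 1 - V * (V * c * c + t * D) = D * (D - V * t) by nra.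
  by field; rewrite !gt_eqF// subr_gt0.
- move=> _ [a _ <-]; rewrite -[a](addrK g) fVW_shift.
  set b := a + g.
  rewrite ler_pdivrMr ?fVW_denom_gt0// mulrAC ler_pdivlMr ?subr_gt0//.
  rewrite cosD cosB -/c.
  (* The sign of [sin g] is absorbed into [y], so that [t] can stand for [sin g]. After
     cross-multiplication the goal amounts to V t (D y + V c x) <= V t. *)
  set x := cos b; set y := Num.sg (sin g) * sin b.
  have sE : sin b * sin g = t * y by rewrite /y [in LHS]sgE; ring.
  rewrite sE.
  have xy : x ^+ 2 + y ^+ 2 <= 1.
    rewrite /y exprMn -(cos2Dsin2 b) lerD2l.
    by rewrite ler_piMl// sqr_ge0.
  (* Cauchy-Schwarz for the unit vector (D, V c), by [DC], and the point (y, x) of the unit disc. *)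
  have cs : D * y + V * c * x <= 1.
    by have := sqr_ge0 (D - y); have := sqr_ge0 (V * c - x); nra.
  have : V * t * (D * y + V * c * x) <= V * t by rewrite ler_piMr// mulr_ge0.
  nra.
Qed.

(** In the variable b = a + g the map [a] to [- a - g *+ 2] is b to -b, which exchanges numerator
    and denominator up to evenness of the cosine. *)
Lemma fVW_reflect (R : realType) (V a g : R) :
  fVW V V (- a - g *+ 2) (g *+ 2 - pi) = (fVW V V a (g *+ 2 - pi))^-1.
Proof.
have -> : - a - g *+ 2 = - (a + g) - g by ring.
rewrite fVW_shift -[in RHS](addrK g a) fVW_shift invf_div.
have -> : - (a + g) + g = - (a + g - g) by ring.
by rewrite -opprD !cosN.
Qed.

(** The reflection sends a maximizer to a minimizer. Applying the upper bound at the reflected point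
    and inverting gives the lower bound, all values being positive. *)
Lemma minima_fVW (R : realType) (V g : R) : 0 <= V < 1 ->
  minima (range (fun alpha => fVW V V alpha (g *+ 2 - pi)))
    ((profile V `|sin g|)^-1 ^+ 2).
Proof.
move=> V01; have [[a _ aE] amax] := maxima_fVW g V01; rewrite exprVn -aE.
split; first by exists (- a - g *+ 2) => //; rewrite fVW_reflect.
move=> _ [b _ <-].
have : fVW V V (- b - g *+ 2) (g *+ 2 - pi) <= profile V `|sin g| ^+ 2.
  by apply: amax; exists (- b - g *+ 2).
rewrite fVW_reflect -aE => ba.
have p0 : 0 < (fVW V V a (g *+ 2 - pi))^-1.
  by rewrite aE invr_gt0 exprn_gt0// profile_gt0.
have b0 : 0 < (fVW V V b (g *+ 2 - pi))^-1.
  rewrite invr_gt0 -[b](addrK g) fVW_shift divr_gt0 ?fVW_denom_gt0//.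
by rewrite -[leRHS]invrK lef_pV2 ?posrE// -invr_gt0.
Qed.

(** The value chosen by [get] is a maximum, hence by uniqueness the square found above; positivity
    of the profile lets the root undo the square. *)
Lemma GmaxE (R : realType) (V g : R) : 0 <= V < 1 ->
  Gmax V g = profile V `|sin g|.
Proof.
move=> V01; rewrite /Gmax (maxima_unique (fmaxP V _ V01) (maxima_fVW g V01)).
by rewrite sqrtr_sqr ger0_norm// ltW// profile_gt0.
Qed.

Lemma GminE (R : realType) (V g : R) : 0 <= V < 1 ->
  Gmin V g = (profile V `|sin g|)^-1.
Proof.
move=> V01; rewrite /Gmin (minima_unique (fminP V _ V01) (minima_fVW g V01)).
by rewrite sqrtr_sqr ger0_norm// invr_ge0 ltW// profile_gt0.
Qed.

Theorem theorem21 (R : realType) (V1 : R) (hV1 : 0 <= V1 < 1) :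
  [/\ periodic (Gmax V1) pi,
      (forall gamma : R, Gmax V1 (- gamma) = Gmax V1 gamma),
      (maxima (range (Gmax V1)) (Num.sqrt ((1 + V1) / (1 - V1))) /\
       minima (range (Gmax V1)) 1),
      ((forall gamma : R, odd_multiples_pihalf R gamma ->
          Gmax V1 gamma = Num.sqrt ((1 + V1) / (1 - V1))) /\
       (forall gamma : R, multiples_pi R gamma -> Gmax V1 gamma = 1))
    & oscillates_monotonically (Gmax V1) (Num.sqrt ((1 + V1) / (1 - V1))) 1
        (odd_multiples_pihalf R) (multiples_pi R)]
  /\
  [/\ periodic (Gmin V1) pi,
      (forall gamma : R, Gmin V1 (- gamma) = Gmin V1 gamma),
      (maxima (range (Gmin V1)) 1 /\
       minima (range (Gmin V1)) (Num.sqrt ((1 - V1) / (1 + V1)))),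
      ((forall gamma : R, multiples_pi R gamma -> Gmin V1 gamma = 1) /\
       (forall gamma : R, odd_multiples_pihalf R gamma ->
          Gmin V1 gamma = Num.sqrt ((1 - V1) / (1 + V1))))
    & oscillates_monotonically (Gmin V1) 1 (Num.sqrt ((1 - V1) / (1 + V1)))
        (multiples_pi R) (odd_multiples_pihalf R)].
Proof.
have Gmax_profile : Gmax V1 = profile V1 \o (fun x => `|sin x|).
  by apply/funext => x; exact: GmaxE.
have Gmin_profile : Gmin V1 = (fun t => (profile V1 t)^-1) \o (fun x => `|sin x|).
  by apply/funext => x; exact: GminE.
have h0 (x : R) : 0 <= `|sin x| by exact: normr_ge0.
have nd := profile_nondecreasing hV1.
have ni : {in Num.nneg &, {homo (fun t => (profile V1 t)^-1) : x y /~ x <= y}}.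
  move=> x y x0 y0 xy; rewrite !nnegrE in x0 y0.
  by rewrite lef_pV2 ?posrE ?profile_gt0// nd.
have V10 : 0 <= (1 + V1) / (1 - V1).
  by have /andP[? ?] := hV1; rewrite divr_ge0//; lra.
have p0 := profile0 hV1; have p1 := profile1 hV1.
have p1V : Num.sqrt ((1 - V1) / (1 + V1)) = (profile V1 1)^-1.
  by rewrite -[in LHS]invf_div sqrtrV// p1.
have p0V : (profile V1 0)^-1 = 1 by rewrite p0 invr1.
(* With the square roots written through the profile at 1, each claim is a transport from |sin|; the
   extreme value 1 comes from the profile at 0. *)
rewrite -p1 p1V Gmax_profile Gmin_profile; split; split.
- by move=> x; rewrite /= norm_sinDpi.
- by move=> x; rewrite /= sinN normrN.
- split; first exact: maxima_range_nondecreasing (@maxima_norm_sin R).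
  have := minima_range_nondecreasing h0 nd (@minima_norm_sin R).
  by rewrite p0.
- split=> x hx /=; first by rewrite norm_sin_odd_multiples_pihalf.
  by rewrite norm_sin_multiples_pi.
- have := oscillates_comp_nondecreasing h0 nd (@oscillates_norm_sin R).
  by rewrite p0.
- by move=> x; rewrite /= norm_sinDpi.
- by move=> x; rewrite /= sinN normrN.
- split; last exact: (minima_range_nonincreasing h0 ni (@maxima_norm_sin R)).
  by have := maxima_range_nonincreasing h0 ni (@minima_norm_sin R); rewrite p0V.
- split=> x hx /=; last by rewrite norm_sin_odd_multiples_pihalf.
  by rewrite norm_sin_multiples_pi.
- have := oscillates_comp_nonincreasing h0 ni (@oscillates_norm_sin R).
  by rewrite p0V.
Qed.
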